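(* Let $n\ge 7$. If $n$ is odd, put $k=\binom{n-7}{(n-7)/2}-1$; if $n$ is even, put $k=2\binom{n-8}{(n-8)/2}-1$ (where $\binom{0}{0}=1$). Then $h(n,k)$ does not exist: for every positive integer $N$ there is a set $\mathcal X$ of at least $N$ points in the plane in general position such that every convex $n$-gon with vertices in $\mathcal X$ contains more than $k$ points of $\mathcal X$ in its interior.
   Context: A finite planar point set is in general position if no three of its points are collinear. For integers $n\ge3$, $k\ge0$, $h(n,k)$ is the least positive integer (if it exists) such that every planar set $\mathcal X$ in general position with at least $h(n,k)$ points contains a convex $n$-gon $C$ with vertices in $\mathcal X$ whose interior contains at most $k$ points of $\mathcal X$. *)

(* Defs.v *)
From Stdlib Require Import Reals List Arith.
Import ListNotations.
Open Scope R_scope.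

Definition point := (R * R)%type.

(* Twice the signed area of triangle p q r: > 0 iff p,q,r is counterclockwise,
   = 0 iff p,q,r are collinear. *)
Definition orient (p q r : point) : R :=
  (fst q - fst p) * (snd r - snd p) - (snd q - snd p) * (fst r - fst p).

Definition general_position (X : list point) : Prop :=
  forall p q r, In p X -> In q X -> In r X ->
    p <> q -> q <> r -> p <> r -> orient p q r <> 0.

Definition vtx (V : list point) (i : nat) : point := nth i V (0, 0).

(* V = [v_0; ...; v_{n-1}] lists the vertices of a (strictly) convex n-gon in
   counterclockwise order, all vertices taken from X: every vertex v_j lies
   strictly to the left of each edge v_i v_{i+1 mod n} not incident to it. *)
Definition convex_ngon_in (n : nat) (X : list point) (V : list point) : Prop :=
  length V = n /\ NoDup V /\ (forall v, In v V -> In v X) /\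
  forall i j, (i < n)%nat -> (j < n)%nat -> j <> i -> j <> ((i + 1) mod n)%nat ->
    orient (vtx V i) (vtx V ((i + 1) mod n)) (vtx V j) > 0.

Definition in_interior (V : list point) (p : point) : Prop :=
  forall i, (i < length V)%nat ->
    orient (vtx V i) (vtx V ((i + 1) mod length V)) p > 0.

Fixpoint binom (n k : nat) : nat :=
  match n, k with
  | _, O => 1%nat
  | O, S _ => 0%nat
  | S n', S k' => (binom n' k' + binom n' k)%nat
  end.

Definition kval (n : nat) : nat :=
  if Nat.odd n then (binom (n - 7) ((n - 7) / 2) - 1)%nat
  else (2 * binom (n - 8) ((n - 8) / 2) - 1)%nat.

(* Main.v *)
Require Import Defs.
From Stdlib Require Import Reals List Arith.
From Stdlib Require Import Lra Lia Psatz Classical.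
Import ListNotations.
Open Scope R_scope.

(* Each point of a Horton set H is replaced by a tiny, almost vertical copy of an
   Erdős–Szekeres set Y of binom (2u) u points having no (u+2)-cup and no (u+2)-cap.
   Let W be the vertex set of a convex n-gon meeting several clusters. A third vertex far
   away forces the vertices in the leftmost cluster to form a cup and those in the rightmost
   one to form a cap, so at most 2u + 2 vertices lie there. Every other cluster contains at
   most one vertex: of two vertices in it, one lies in the triangle formed by the other and
   the extreme ones. So at least n - 2u clusters are met, and they form a convex polygon
   in H. By Horton's argument a convex polygon in H with l vertices has at least l - 6
   points of H in its interior: it consists of a cup in the lower half and a cap in the
   upper half of H, and a cup with c points has at least c - 3 points above it. The whole
   clusters at these interior points lie inside the n-gon. With n = 2u + 7 there is at
   least one such cluster, with n = 2u + 8 at least two. Convexity is used only in the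
   form: no vertex lies in the open triangle spanned by three vertices. *)

(** * Orientations, triangles and convex polygons *)

Lemma orient_cycle p q r : orient q r p = orient p q r.
Proof. unfold orient; ring. Qed.

Lemma orient_swap p q r : orient q p r = - orient p q r.
Proof. unfold orient; ring. Qed.

Definition tri_in (p a b c : point) : Prop :=
  (0 < orient a b p /\ 0 < orient b c p /\ 0 < orient c a p) \/
  (orient a b p < 0 /\ orient b c p < 0 /\ orient c a p < 0).

(** The map [P] lets the same notion serve indices of a graph and pairs naming points of a
    blow-up. *)
Definition inner {A} (P : A -> point) (l : list A) (q : point) : Prop :=
  exists a b c, In a l /\ In b l /\ In c l /\ tri_in q (P a) (P b) (P c).

Definition convex_pos {A} (P : A -> point) (l : list A) : Prop :=
  forall p, In p l -> ~ inner P l (P p).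

Lemma convex_pos_incl {A} (P : A -> point) l l' :
  incl l' l -> convex_pos P l -> convex_pos P l'.
Proof.
  intros I C p Hp (a & b & c & Ha & Hb & Hc & T). apply (C p (I p Hp)). exists a, b, c. auto.
Qed.

(* Barycentric coordinates: [orient v w] is affine in its last argument. *)
Lemma orient_barycentric v w a b c p :
  (orient a b p + orient b c p + orient c a p) * orient v w p =
  orient b c p * orient v w a + orient c a p * orient v w b + orient a b p * orient v w c.
Proof. unfold orient; ring. Qed.

Lemma tri_in_distinct p a b c : tri_in p a b c -> a <> b /\ b <> c /\ a <> c.
Proof.
  intros H.
  assert (Z : forall q, orient q q p = 0) by (intro; unfold orient; ring).
  pose proof (Z a). pose proof (Z b). pose proof (Z c).
  repeat split; intros E; rewrite E in *; destruct H as [H|H]; try lra.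
Qed.

Lemma tri_in_above i j k b :
  0 < orient i j b -> 0 < orient j k b -> orient i j k < 0 -> tri_in j i k b.
Proof.
  intros H1 H2 H3. left. rewrite (orient_cycle j k b), <- (orient_cycle b i j).
  rewrite <- (orient_cycle i k j), orient_swap, (orient_cycle i j k). lra.
Qed.

Lemma tri_in_below i j k b :
  orient i j b < 0 -> orient j k b < 0 -> 0 < orient i j k -> tri_in j i k b.
Proof.
  intros H1 H2 H3. right. rewrite (orient_cycle j k b), <- (orient_cycle b i j).
  rewrite <- (orient_cycle i k j), orient_swap, (orient_cycle i j k). lra.
Qed.

(** For an edge [v w], the function [orient v w] is affine, nonnegative at all vertices, and zero
    only at [v] and [w]. Three distinct vertices cannot all be zeros, so a point with positive
    barycentric weights gets a positive value. *)
Lemma tri_in_polygon n X V a b c p :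
  convex_ngon_in n X V -> In a V -> In b V -> In c V -> tri_in p a b c -> in_interior V p.
Proof.
  intros (Hn & ND & _ & E) Ha Hb Hc T i Hi.
  set (v := vtx V i). set (w := vtx V ((i + 1) mod length V)).
  assert (F : forall q, In q V -> (0 < orient v w q) \/ (orient v w q = 0 /\ (q = v \/ q = w))).
  { intros q Hq. destruct (In_nth V q (0,0) Hq) as (j & Hj & <-).
    destruct (Nat.eq_dec j i) as [->|N1].
    - right. split; [unfold v, vtx, orient; ring|now left].
    - destruct (Nat.eq_dec j ((i + 1) mod length V)) as [->|N2].
      + right. split; [unfold w, vtx, orient; ring|now right].
      + left. unfold v, w. rewrite Hn in *. now apply E. }
  pose proof (tri_in_distinct _ _ _ _ T) as (D1 & D2 & D3).
  pose proof (orient_barycentric v w a b c p) as B.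
  assert (G : 0 <= orient v w a /\ 0 <= orient v w b /\ 0 <= orient v w c /\
              (0 < orient v w a \/ 0 < orient v w b \/ 0 < orient v w c)).
  { destruct (F a Ha) as [?|[? Xa]], (F b Hb) as [?|[? Xb]], (F c Hc) as [?|[? Xc]];
      try (repeat split; lra).
    exfalso. destruct Xa, Xb, Xc; congruence. }
  destruct G as (Ga & Gb & Gc & Gs).
  destruct (Rle_or_lt (orient v w p) 0) as [Neg|]; [exfalso|assumption].
  destruct T as [(T1 & T2 & T3)|(T1 & T2 & T3)]; destruct Gs as [Gs|[Gs|Gs]]; nra.
Qed.

Lemma vertex_not_interior V p : In p V -> ~ in_interior V p.
Proof.
  intros Hp H. destruct (In_nth V p (0,0) Hp) as (j & Hj & <-).
  specialize (H j Hj). unfold vtx, orient in H. lra.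
Qed.

(** * Statements valid for all large parameters *)

Definition eventually (P : R -> Prop) : Prop := exists S, forall s, S <= s -> P s.

Lemma eventually_and P Q : eventually P -> eventually Q -> eventually (fun s => P s /\ Q s).
Proof.
  intros [S HS] [T HT]. exists (Rmax S T). intros s Hs.
  pose proof (Rmax_l S T). pose proof (Rmax_r S T). split; [apply HS|apply HT]; lra.
Qed.

Lemma eventually_mono (P Q : R -> Prop) :
  (forall s, P s -> Q s) -> eventually P -> eventually Q.
Proof. intros H [S HS]. exists S. auto. Qed.

Lemma eventually_imp (A : Prop) (P : R -> Prop) :
  (A -> eventually P) -> eventually (fun s => A -> P s).
Proof.
  intros H. destruct (classic A) as [a|na].
  - destruct (H a) as [S HS]. exists S. auto.
  - exists 0. tauto.
Qed.

Lemma eventually_below n (P : nat -> R -> Prop) :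
  (forall i, (i < n)%nat -> eventually (P i)) ->
  eventually (fun s => forall i, (i < n)%nat -> P i s).
Proof.
  induction n as [|n IH]; intros H.
  - exists 0. intros; lia.
  - apply eventually_mono with (fun s => (forall i, (i < n)%nat -> P i s) /\ P n s).
    + intros s [H1 H2] i Hi. destruct (Nat.eq_dec i n) as [->|]; [assumption|apply H1; lia].
    + apply eventually_and; [apply IH; intros; apply H; lia|apply H; lia].
Qed.

Definition to_infty (p : R -> R) : Prop := forall K, eventually (fun s => K < p s).

Lemma to_infty_linear a b : 0 < a -> to_infty (fun s => a * s + b).
Proof.
  intros Ha K. exists ((K - b) / a + 1). intros s Hs.
  assert (a * ((K - b) / a + 1) <= a * s) by (apply Rmult_le_compat_l; lra).
  replace (a * ((K - b) / a + 1)) with (K - b + a) in H by (field; lra). lra.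
Qed.

(** Orientations in the blow-up are polynomials in the parameter. Written in Horner form with a
    positive leading coefficient, they become positive by repeated use of this lemma on top of
    [to_infty_linear]. *)
Lemma to_infty_horner p c : to_infty p -> to_infty (fun s => s * p s + c).
Proof.
  intros H K. destruct (H 1) as [S HS].
  exists (Rmax S (Rmax 1 (K - c + 1))). intros s Hs.
  pose proof (Rmax_l S (Rmax 1 (K - c + 1))). pose proof (Rmax_r S (Rmax 1 (K - c + 1))).
  pose proof (Rmax_l 1 (K - c + 1)). pose proof (Rmax_r 1 (K - c + 1)).
  assert (1 < p s) by (apply HS; lra). nra.
Qed.

Lemma to_infty_pos p q :
  to_infty p -> (forall s, q s = p s) -> eventually (fun s => 0 < q s).
Proof. intros H E. apply eventually_mono with (2 := H 0). intros s. now rewrite E. Qed.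

Lemma to_infty_neg p q :
  to_infty p -> (forall s, q s = - p s) -> eventually (fun s => q s < 0).
Proof. intros H E. apply eventually_mono with (2 := H 0). intros s. rewrite E. lra. Qed.

(** * Lists *)

Lemma list_preimage {A B} (psi : A -> B) (P : A -> Prop) (l : list B) :
  (forall x, In x l -> exists i, P i /\ x = psi i) ->
  exists l', l = map psi l' /\ forall i, In i l' -> P i.
Proof.
  induction l as [|x l IH]; intros H.
  - exists []. split; [reflexivity|intros i []].
  - destruct (H x (or_introl eq_refl)) as (i & Pi & ->).
    destruct IH as (l' & -> & Hl'); [intros y Hy; apply H; now right|].
    exists (i :: l'). split; [reflexivity|]. intros j [<-|Hj]; auto.
Qed.

Lemma NoDup_map_inj {A B} (f : A -> B) l :
  (forall x y, In x l -> In y l -> f x = f y -> x = y) -> NoDup l -> NoDup (map f l).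
Proof.
  induction l as [|x l IH]; intros Hf ND; simpl; constructor; inversion ND; subst.
  - intros H. apply in_map_iff in H as (y & E & Hy).
    apply Hf in E; [subst; contradiction|now right|now left].
  - apply IH; [intros; apply Hf; auto; now right|assumption].
Qed.

Lemma NoDup_prod {A B} (l : list A) (l' : list B) :
  NoDup l -> NoDup l' -> NoDup (list_prod l l').
Proof.
  intros N N'. induction N as [|x l Hx N IH]; simpl; [constructor|].
  apply NoDup_app; [apply NoDup_map_inj; [congruence|assumption]|assumption|].
  intros [a b] H1 H2. apply in_map_iff in H1 as (y & E & _). inversion E; subst.
  apply in_prod_iff in H2. tauto.
Qed.

Lemma exists_argmin {A} (f : A -> nat) l :
  l <> [] -> exists x, In x l /\ forall y, In y l -> (f x <= f y)%nat.
Proof.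
  induction l as [|x l IH]; intros H; [congruence|].
  destruct l as [|y l].
  - exists x. split; [now left|]. intros z [<-|[]]; lia.
  - destruct IH as (z & Hz & Mz); [discriminate|].
    destruct (le_lt_dec (f x) (f z)).
    + exists x. split; [now left|]. intros w [<-|Hw]; [lia|]. specialize (Mz w Hw). lia.
    + exists z. split; [now right|]. intros w [<-|Hw]; [lia|]. auto.
Qed.

Lemma exists_argmax {A} (f : A -> nat) l :
  l <> [] -> exists x, In x l /\ forall y, In y l -> (f y <= f x)%nat.
Proof.
  induction l as [|x l IH]; intros H; [congruence|].
  destruct l as [|y l].
  - exists x. split; [now left|]. intros z [<-|[]]; lia.
  - destruct IH as (z & Hz & Mz); [discriminate|].
    destruct (le_lt_dec (f z) (f x)).
    + exists x. split; [now left|]. intros w [<-|Hw]; [lia|]. specialize (Mz w Hw). lia.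
    + exists z. split; [now right|]. intros w [<-|Hw]; [lia|]. auto.
Qed.

Lemma extract_max (l : list nat) :
  NoDup l -> l <> [] ->
  exists m l', In m l /\ NoDup l' /\ incl l' l /\ length l = S (length l') /\
    forall x, In x l' -> (x < m)%nat.
Proof.
  intros ND NE. destruct (exists_argmax (fun x => x) l NE) as (m & Hm & Mm).
  destruct (in_split m l Hm) as (l1 & l2 & ->).
  exists m, (l1 ++ l2). pose proof (NoDup_remove _ _ _ ND) as [ND' Nm].
  assert (I : incl (l1 ++ l2) (l1 ++ m :: l2)).
  { intros x Hx. apply in_app_iff in Hx. apply in_app_iff. destruct Hx; [left|right; right]; auto. }
  repeat split; auto.
  - rewrite !length_app. simpl. lia.
  - intros x Hx. specialize (Mm x (I x Hx)).
    destruct (Nat.eq_dec x m) as [->|]; [contradiction|lia].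
Qed.

Lemma two_increasing (l : list nat) :
  NoDup l -> (2 <= length l)%nat -> exists x y, In x l /\ In y l /\ (x < y)%nat.
Proof.
  intros ND H. destruct l as [|x [|y l]]; simpl in H; try lia.
  inversion ND as [|? ? Nx _]; subst.
  destruct (lt_eq_lt_dec x y) as [[L|E]|L].
  - exists x, y. simpl; auto.
  - subst. exfalso. apply Nx. now left.
  - exists y, x. simpl; auto.
Qed.

Lemma at_most_one (l : list nat) :
  NoDup l -> (forall x y, In x l -> In y l -> (x < y)%nat -> False) -> (length l <= 1)%nat.
Proof.
  intros ND H. destruct (le_lt_dec (length l) 1) as [|L]; [assumption|exfalso].
  destruct (two_increasing l ND L) as (x & y & ? & ? & ?). eauto.
Qed.

Lemma length_below (l : list nat) n :
  NoDup l -> (forall x, In x l -> (x < n)%nat) -> (length l <= n)%nat.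
Proof.
  intros ND H. rewrite <- (length_seq n 0). apply NoDup_incl_length; [assumption|].
  intros x Hx. apply in_seq. specialize (H x Hx). lia.
Qed.

(** * Planar sets given as graphs over an initial segment of the integers *)

(** Abscissas are the indices themselves, so the order from left to right is the order of the
    naturals. *)
Definition graph_pt (f : nat -> R) (i : nat) : point := (INR i, f i).

Definition turn (f : nat -> R) (i j k : nat) : R :=
  orient (graph_pt f i) (graph_pt f j) (graph_pt f k).

(** All increasing triples are tested, not only consecutive ones, so [l] need not be sorted and the
    property passes to sublists at once. *)
Definition cup (f : nat -> R) (l : list nat) : Prop :=
  forall i j k, In i l -> In j l -> In k l -> (i < j)%nat -> (j < k)%nat -> 0 < turn f i j k.

Definition cap (f : nat -> R) (l : list nat) : Prop :=
  forall i j k, In i l -> In j l -> In k l -> (i < j)%nat -> (j < k)%nat -> turn f i j k < 0.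

Definition no_three_collinear (n : nat) (f : nat -> R) : Prop :=
  forall i j k, (i < j)%nat -> (j < k)%nat -> (k < n)%nat -> turn f i j k <> 0.

(** Reflection in the horizontal axis; it exchanges cups with caps and lower with upper halves. *)
Definition opp (f : nat -> R) (i : nat) : R := - f i.

Lemma turn_opp f i j k : turn (opp f) i j k = - turn f i j k.
Proof. unfold turn, orient, graph_pt, opp; simpl; ring. Qed.

Lemma turn_cycle f i j k : turn f j k i = turn f i j k.
Proof. apply orient_cycle. Qed.

Lemma turn_swap f i j k : turn f j i k = - turn f i j k.
Proof. apply orient_swap. Qed.

Lemma no_three_collinear_distinct n f i j k :
  no_three_collinear n f -> (i < n)%nat -> (j < n)%nat -> (k < n)%nat ->
  i <> j -> j <> k -> i <> k -> turn f i j k <> 0.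
Proof.
  intros H Hi Hj Hk D1 D2 D3.
  pose proof (turn_swap f i j k). pose proof (turn_swap f j k i). pose proof (turn_swap f k i j).
  pose proof (turn_cycle f i j k). pose proof (turn_cycle f j k i).
  destruct (lt_eq_lt_dec i j) as [[L1|]|L1], (lt_eq_lt_dec j k) as [[L2|]|L2],
    (lt_eq_lt_dec i k) as [[L3|]|L3]; try lia;
  match goal with
  | A : (?x < ?y)%nat, B : (?y < ?z)%nat |- _ => assert (turn f x y z <> 0) by (apply H; lia)
  end; lra.
Qed.

(** An affine copy of one graph inside another; [c] is the determinant of the affine map, 2 for a
    parity class and 1 for a translate. *)
Definition embeds (m : nat) (f' f : nat -> R) (psi : nat -> nat) : Prop :=
  (forall i j, (i < j)%nat -> (psi i < psi j)%nat) /\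
  exists c, 0 < c /\ forall i j k, (i < m)%nat -> (j < m)%nat -> (k < m)%nat ->
    turn f (psi i) (psi j) (psi k) = c * turn f' i j k.

Section Embedding.

Variables (m : nat) (f' f : nat -> R) (psi : nat -> nat) (l : list nat).
Hypotheses (E : embeds m f' f psi) (Hl : forall i, In i l -> (i < m)%nat).

Lemma embeds_cup : cup f (map psi l) -> cup f' l.
Proof.
  destruct E as (M & c & Hc & EO). intros C i j k Hi Hj Hk L1 L2.
  assert (P : 0 < turn f (psi i) (psi j) (psi k)) by (apply C; auto using in_map).
  rewrite EO in P by auto. nra.
Qed.

Lemma embeds_cap : cap f (map psi l) -> cap f' l.
Proof.
  destruct E as (M & c & Hc & EO). intros C i j k Hi Hj Hk L1 L2.
  assert (P : turn f (psi i) (psi j) (psi k) < 0) by (apply C; auto using in_map).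
  rewrite EO in P by auto. nra.
Qed.

Lemma embeds_tri_in p a b c : (p < m)%nat -> (a < m)%nat -> (b < m)%nat -> (c < m)%nat ->
  tri_in (graph_pt f' p) (graph_pt f' a) (graph_pt f' b) (graph_pt f' c) ->
  tri_in (graph_pt f (psi p)) (graph_pt f (psi a)) (graph_pt f (psi b)) (graph_pt f (psi c)).
Proof.
  destruct E as (M & d & Hd & EO). intros Hp Ha Hb Hc.
  unfold tri_in. fold (turn f (psi a) (psi b) (psi p)) (turn f (psi b) (psi c) (psi p))
    (turn f (psi c) (psi a) (psi p)) (turn f' a b p) (turn f' b c p) (turn f' c a p).
  rewrite !EO by assumption. intros [(?&?&?)|(?&?&?)]; [left|right]; repeat split; nra.
Qed.

Lemma embeds_inner p : (p < m)%nat ->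
  inner (graph_pt f') l (graph_pt f' p) -> inner (graph_pt f) (map psi l) (graph_pt f (psi p)).
Proof.
  intros Hp (a & b & c & Ha & Hb & Hc & T).
  exists (psi a), (psi b), (psi c). repeat split; auto using in_map, embeds_tri_in.
Qed.

Lemma embeds_convex_pos :
  convex_pos (graph_pt f) (map psi l) -> convex_pos (graph_pt f') l.
Proof. intros C p Hp I. apply (C (psi p)); auto using in_map, embeds_inner. Qed.

End Embedding.

(** * Horton sets *)

Definition parity_class (b : bool) (i : nat) : nat := 2 * i + Nat.b2n b.

Definition restrict (b : bool) (f : nat -> R) (i : nat) : R := f (parity_class b i).

(* The points of parity [s] lie below all lines spanned by points of the other parity,
   and vice versa. *)
Definition separated (s : bool) (n : nat) (f : nat -> R) : Prop :=
  forall i j k, (i < j)%nat -> (j < n)%nat -> (k < n)%nat ->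
    Nat.odd i = Nat.odd j -> Nat.odd k <> Nat.odd i ->
    (Nat.odd i = s -> 0 < turn f i j k) /\ (Nat.odd i <> s -> turn f i j k < 0).

(* Horton sets; the order of the two halves is left free, so that the notion is
   invariant under reflection [opp]. *)
Fixpoint horton (t : nat) (f : nat -> R) : Prop :=
  match t with
  | 0%nat => True
  | S t' => (forall b, horton t' (restrict b f)) /\ exists s, separated s (2 ^ t) f
  end.

Lemma parity_class_odd b i : Nat.odd (parity_class b i) = b.
Proof.
  unfold parity_class. rewrite Nat.add_comm, Nat.odd_add_mul_2. now destruct b.
Qed.

Lemma parity_class_bound b i t : (i < 2 ^ t)%nat -> (parity_class b i < 2 ^ S t)%nat.
Proof. intros H. unfold parity_class. simpl. destruct b; simpl; lia. Qed.

Lemma parity_class_intro x t :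
  (x < 2 ^ S t)%nat -> exists i, (i < 2 ^ t)%nat /\ x = parity_class (Nat.odd x) i.
Proof.
  intros H. exists (Nat.div2 x). pose proof (Nat.div2_odd x) as E.
  split; [simpl in H; lia|]. exact E.
Qed.

Lemma embeds_parity m b f : embeds m (restrict b f) f (parity_class b).
Proof.
  split; [unfold parity_class; intros; lia|]. exists 2. split; [lra|].
  assert (P : forall i, graph_pt f (parity_class b i) =
                (2 * INR i + INR (Nat.b2n b), restrict b f i)).
  { intros i. unfold graph_pt, restrict. f_equal. unfold parity_class.
    rewrite plus_INR, mult_INR. reflexivity. }
  intros i j k _ _ _. unfold turn. rewrite !P. unfold orient, graph_pt; simpl fst; simpl snd. ring.
Qed.

Lemma separated_opp s n f : separated s n f -> separated (negb s) n (opp f).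
Proof.
  intros Hs i j k L1 L2 L3 E N. rewrite !turn_opp.
  destruct (Hs i j k L1 L2 L3 E N) as [H1 H2].
  split; intros Q.
  - enough (turn f i j k < 0) by lra. apply H2. rewrite Q. now destruct s.
  - enough (0 < turn f i j k) by lra. apply H1. destruct (Nat.odd i), s; simpl in *; congruence.
Qed.

Lemma horton_opp t : forall f, horton t f -> horton t (opp f).
Proof.
  induction t as [|t IH]; intros f; [trivial|]. intros [H (s & Hs)]. split.
  - intros b. exact (IH _ (H b)).
  - exists (negb s). now apply separated_opp.
Qed.

(** Three points of equal parity are handled by induction. Otherwise two of them share a parity and
    the third does not, and [separated] gives a nonzero sign after permuting the points. *)
Lemma horton_general t : forall f, horton t f -> no_three_collinear (2 ^ t) f.
Proof.
  induction t as [|t IH]; intros f H i j k L1 L2 L3; [simpl in L3; lia|].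
  destruct H as [H (s & Hs)].
  pose proof (turn_cycle f i j k). pose proof (turn_swap f i k j). pose proof (turn_cycle f k i j).
  assert (S3 : forall x y z, (x < y)%nat -> (y < 2 ^ S t)%nat -> (z < 2 ^ S t)%nat ->
    Nat.odd x = Nat.odd y -> Nat.odd z <> Nat.odd x -> turn f x y z <> 0).
  { intros x y z A1 A2 A3 A4 A5. destruct (Hs x y z A1 A2 A3 A4 A5) as [P N].
    destruct (Bool.bool_dec (Nat.odd x) s) as [q|q]; [specialize (P q)|specialize (N q)]; lra. }
  destruct (Bool.bool_dec (Nat.odd i) (Nat.odd j)) as [e1|n1].
  - destruct (Bool.bool_dec (Nat.odd k) (Nat.odd i)) as [e2|n2].
    + destruct (parity_class_intro i t) as (i' & Hi & Ei); [lia|].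
      destruct (parity_class_intro j t) as (j' & Hj & Ej); [lia|].
      destruct (parity_class_intro k t) as (k' & Hk & Ek); [lia|].
      rewrite e2, e1 in Ek. rewrite e1 in Ei. set (b := Nat.odd j) in *. clearbody b.
      destruct (embeds_parity (2 ^ t) b f) as (_ & c & Hc & EO).
      rewrite Ei, Ej, Ek, EO by assumption.
      assert (turn (restrict b f) i' j' k' <> 0)
        by (apply (IH _ (H b)); unfold parity_class in *; simpl in L3; lia).
      nra.
    + apply S3; auto; lia.
  - destruct (Bool.bool_dec (Nat.odd i) (Nat.odd k)) as [e2|n2].
    + assert (turn f i k j <> 0) by (apply S3; auto; lia). lra.
    + assert (turn f j k i <> 0).
      { apply S3; auto; try lia. destruct (Nat.odd i), (Nat.odd j), (Nat.odd k); congruence. }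
      lra.
Qed.

(** * Points inside convex polygons of Horton sets *)

Definition has_parity (s : bool) (x : nat) : bool := Bool.eqb (Nat.odd x) s.

Lemma has_parity_iff s x : has_parity s x = true <-> Nat.odd x = s.
Proof. apply Bool.eqb_true_iff. Qed.

Lemma filter_parity_split s (l : list nat) :
  length l = (length (filter (has_parity s) l) + length (filter (has_parity (negb s)) l))%nat.
Proof.
  induction l as [|x l IH]; [reflexivity|].
  assert (E : has_parity (negb s) x = negb (has_parity s x))
    by (unfold has_parity; destruct (Nat.odd x), s; reflexivity).
  simpl. rewrite E. destruct (has_parity s x); simpl; lia.
Qed.

Lemma parity_preimage s t (l : list nat) :
  (forall x, In x l -> (x < 2 ^ S t)%nat) -> (forall x, In x l -> Nat.odd x = s) ->
  exists l', l = map (parity_class s) l' /\ forall i, In i l' -> (i < 2 ^ t)%nat.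
Proof.
  intros B P. apply list_preimage. intros x Hx.
  destruct (parity_class_intro x t (B x Hx)) as (i & Hi & E). rewrite (P x Hx) in E. eauto.
Qed.

Lemma NoDup_parity_class s l : NoDup l -> NoDup (map (parity_class s) l).
Proof. apply NoDup_map_inj. unfold parity_class. intros; lia. Qed.

(** The points of [D] lie above chords of the cup. A cup inside the upper half is treated by
    induction. A cup that meets the lower half has at most two points in the upper one, and each of
    its lower points except the last yields a point of [D]; two upper points and one last point make
    up the 3. *)
Lemma horton_cup t : forall f l, horton t f -> NoDup l ->
  (forall x, In x l -> (x < 2 ^ t)%nat) -> cup f l ->
  exists D, NoDup D /\ (length l <= 3 + length D)%nat /\
    forall p, In p D -> (p < 2 ^ t)%nat /\
      exists i j, In i l /\ In j l /\ (i < p)%nat /\ (p < j)%nat /\ turn f i p j < 0.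
Proof.
  induction t as [|t IH]; intros f l H ND B C.
  - exists []. split; [constructor|]. split; [|intros p []].
    pose proof (length_below l 1 ND B). simpl; lia.
  - destruct H as [H (s & Hs)].
    pose proof (filter_parity_split s l) as Len.
    destruct (filter (has_parity s) l) as [|a L0] eqn:EL.
    + destruct (parity_preimage (negb s) t l B) as (l' & -> & B').
      { intros x Hx. destruct (Bool.bool_dec (Nat.odd x) s) as [e|n].
        - apply has_parity_iff in e.
          assert (F : In x (filter (has_parity s) l)) by (apply filter_In; auto).
          rewrite EL in F. destruct F.
        - destruct (Nat.odd x), s; simpl; congruence. }
      pose proof (embeds_parity (2 ^ t) (negb s) f) as Emb.
      destruct (IH (restrict (negb s) f) l' (H _) (NoDup_map_inv _ _ ND) B'
                  (embeds_cup _ _ _ _ _ Emb B' C)) as (D & NDD & LD & HD).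
      exists (map (parity_class (negb s)) D).
      split; [now apply NoDup_parity_class|]. rewrite !length_map. split; [assumption|].
      intros p Hp. apply in_map_iff in Hp as (q & <- & Hq).
      destruct (HD q Hq) as (Bq & i & j & Hi & Hj & L1 & L2 & Oq).
      split; [now apply parity_class_bound|].
      destruct Emb as (M & c & Hc & EO).
      exists (parity_class (negb s) i), (parity_class (negb s) j).
      repeat split; auto using in_map. rewrite EO by auto. nra.
    + rewrite <- EL in *.
      (* Two points of the upper half on the same side of [a] would form a cap with it. *)
      assert (LU : (length (filter (has_parity (negb s)) l) <= 2)%nat).
      { assert (Ha : In a l /\ Nat.odd a = s).
        { assert (F : In a (filter (has_parity s) l)) by (rewrite EL; now left).
          apply filter_In in F as [F1 F2]. apply has_parity_iff in F2. auto. }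
        destruct Ha as [Ha Pa].
        set (U := filter (has_parity (negb s)) l).
        assert (HU : forall x, In x U -> In x l /\ Nat.odd x = negb s).
        { intros x Hx. apply filter_In in Hx as [F1 F2]. apply has_parity_iff in F2. auto. }
        assert (NU : NoDup U) by now apply NoDup_filter.
        rewrite <- (filter_length (fun x => (x <? a)%nat) U).
        assert (Neg : forall x y, In x U -> In y U -> (x < y)%nat -> turn f x y a < 0).
        { intros x y Hx Hy L. apply HU in Hx as [? Px]. apply HU in Hy as [? Py].
          apply Hs; auto; rewrite ?Px, ?Py, ?Pa; destruct s; simpl; congruence. }
        assert (L1 : (length (filter (fun x => (x <? a)%nat) U) <= 1)%nat).
        { apply at_most_one; [now apply NoDup_filter|]. intros x y Hx Hy L.
          apply filter_In in Hx as [Hx _]. apply filter_In in Hy as [Hy Ly].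
          apply Nat.ltb_lt in Ly.
          assert (0 < turn f x y a) by (apply C; auto; now apply HU).
          specialize (Neg x y Hx Hy L). lra. }
        assert (L2 : (length (filter (fun x => negb (x <? a)%nat) U) <= 1)%nat).
        { apply at_most_one; [now apply NoDup_filter|]. intros x y Hx Hy L.
          apply filter_In in Hx as [Hx Lx]. apply filter_In in Hy as [Hy _].
          apply Bool.negb_true_iff, Nat.ltb_ge in Lx.
          assert (x <> a).
          { intros ->. apply HU in Hx as [_ Px]. rewrite Pa in Px. now destruct s. }
          assert (P : 0 < turn f a x y).
          { apply C; auto; try lia; now apply HU. }
          rewrite <- turn_cycle in P.
          specialize (Neg x y Hx Hy L). lra. }
        lia. }
      (* Right after each lower point there is a point of the upper half. *)
      destruct (extract_max (filter (has_parity s) l)) as (m & L' & Hm & ND' & I' & E' & M').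
      { now apply NoDup_filter. }
      { rewrite EL. discriminate. }
      exists (map S L'). split; [apply NoDup_map_inj; auto|].
      split; [rewrite length_map; lia|].
      intros p Hp. apply in_map_iff in Hp as (x & <- & Hx).
      pose proof (M' x Hx) as Lx. apply I' in Hx.
      apply filter_In in Hm as [Hm Pm]. apply filter_In in Hx as [Hx Px].
      apply has_parity_iff in Pm, Px. pose proof (B m Hm).
      assert (Podd : Nat.odd (S x) = negb s) by (rewrite Nat.odd_succ, <- Nat.negb_odd; congruence).
      assert (S x <> m) by (intros <-; rewrite Pm in Podd; now destruct s).
      split; [lia|]. exists x, m. repeat split; auto; try lia.
      assert (P : 0 < turn f x m (S x)).
      { apply Hs; auto; try lia; rewrite ?Podd, ?Px, ?Pm; try (destruct s; simpl; congruence). }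
      pose proof (turn_swap f x m (S x)). pose proof (turn_cycle f m x (S x)).
      pose proof (turn_cycle f x m (S x)). lra.
Qed.

(** The vertex [u] of the upper half lies above every line spanned by the lower half. Were three
    lower vertices a cap, the middle one would lie in the triangle of the other two and [u]; so they
    form a cup. A point of the lower half above a chord of this cup lies in the triangle of the
    chord and [u]. *)
Lemma horton_polygon_lower t f s l u :
  horton t (restrict s f) -> separated s (2 ^ S t) f -> NoDup l ->
  (forall x, In x l -> (x < 2 ^ S t)%nat) -> convex_pos (graph_pt f) l ->
  In u l -> Nat.odd u <> s ->
  exists D, NoDup D /\ (length (filter (has_parity s) l) <= 3 + length D)%nat /\
    forall p, In p D ->
      Nat.odd p = s /\ (p < 2 ^ S t)%nat /\ inner (graph_pt f) l (graph_pt f p).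
Proof.
  intros H Hs ND B C Hu Pu.
  assert (HL : forall x, In x (filter (has_parity s) l) -> In x l /\ Nat.odd x = s).
  { intros x Hx. apply filter_In in Hx as [F1 F2]. apply has_parity_iff in F2. auto. }
  assert (NL : NoDup (filter (has_parity s) l)) by now apply NoDup_filter.
  assert (Pos : forall x y, Nat.odd x = s -> Nat.odd y = s -> (x < y)%nat ->
            (y < 2 ^ S t)%nat -> 0 < turn f x y u).
  { intros x y Px Py L By. apply Hs; auto; congruence. }
  destruct (parity_preimage s t (filter (has_parity s) l)) as (l' & El & B').
  { intros x Hx. apply B. now apply HL. }
  { intros x Hx. now apply HL. }
  rewrite El in *.
  pose proof (embeds_parity (2 ^ t) s f) as Emb.
  assert (Cup : cup (restrict s f) l').
  { apply (embeds_cup (2 ^ t) _ f (parity_class s)); auto.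
    intros i j k Hi Hj Hk L1 L2.
    apply HL in Hi as [Hi Pi]. apply HL in Hj as [Hj Pj]. apply HL in Hk as [Hk Pk].
    destruct (Rlt_le_dec 0 (turn f i j k)) as [|Le]; [assumption|exfalso].
    assert (NZ : turn f i j k <> 0).
    { destruct (parity_class_intro i t (B i Hi)) as (i' & Bi & Ei).
      destruct (parity_class_intro j t (B j Hj)) as (j' & Bj & Ej).
      destruct (parity_class_intro k t (B k Hk)) as (k' & Bk & Ek).
      rewrite Pi in Ei. rewrite Pj in Ej. rewrite Pk in Ek.
      destruct Emb as (_ & c & Hc & EO). rewrite Ei, Ej, Ek, EO by assumption.
      assert (turn (restrict s f) i' j' k' <> 0)
        by (apply (horton_general t _ H); unfold parity_class in *; lia).
      nra. }
    apply (C j Hj). exists i, k, u. repeat split; auto.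
    apply tri_in_above; [now apply Pos; auto|now apply Pos; auto|unfold turn in *; lra]. }
  destruct (horton_cup t _ l' H (NoDup_map_inv _ _ NL) B' Cup) as (D & NDD & LD & HD).
  exists (map (parity_class s) D). rewrite !length_map.
  split; [now apply NoDup_parity_class|]. split; [assumption|].
  intros p Hp. apply in_map_iff in Hp as (q & <- & Hq).
  destruct (HD q Hq) as (Bq & i & j & Hi & Hj & L1 & L2 & Oq).
  split; [apply parity_class_odd|]. split; [now apply parity_class_bound|].
  destruct Emb as (M & c & Hc & EO).
  assert (Q : turn f (parity_class s i) (parity_class s q) (parity_class s j) < 0)
    by (rewrite EO by auto; nra).
  pose proof (M _ _ L1). pose proof (M _ _ L2).
  assert (Pi := HL _ (in_map (parity_class s) _ _ Hi)).
  assert (Pj := HL _ (in_map (parity_class s) _ _ Hj)).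
  pose proof (parity_class_odd s q) as Pq. pose proof (parity_class_bound s q t Bq) as Bq'.
  set (i1 := parity_class s i) in *. set (q1 := parity_class s q) in *.
  set (j1 := parity_class s j) in *.
  exists i1, j1, u. repeat split; try tauto.
  apply tri_in_above; [apply Pos; tauto|apply Pos; try tauto; apply B; tauto|exact Q].
Qed.

Lemma tri_in_opp f p a b c :
  tri_in (graph_pt (opp f) p) (graph_pt (opp f) a) (graph_pt (opp f) b) (graph_pt (opp f) c) <->
  tri_in (graph_pt f p) (graph_pt f a) (graph_pt f b) (graph_pt f c).
Proof.
  unfold tri_in. fold (turn (opp f) a b p) (turn (opp f) b c p) (turn (opp f) c a p)
    (turn f a b p) (turn f b c p) (turn f c a p). rewrite !turn_opp.
  split; (intros [(?&?&?)|(?&?&?)]; [right|left]; repeat split; lra).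
Qed.

Lemma inner_opp f l p :
  inner (graph_pt (opp f)) l (graph_pt (opp f) p) <-> inner (graph_pt f) l (graph_pt f p).
Proof.
  split; intros (a & b & c & Ha & Hb & Hc & T); exists a, b, c; repeat split; auto;
    now apply tri_in_opp.
Qed.

(** The constant 6 is 3 for the cup in the lower half plus 3 for the cap in the upper half, which
    [opp] turns into a cup. *)
Lemma horton_polygon t : forall f l, horton t f -> NoDup l ->
  (forall x, In x l -> (x < 2 ^ t)%nat) -> convex_pos (graph_pt f) l ->
  exists D, NoDup D /\ (length l <= 6 + length D)%nat /\
    forall p, In p D -> (p < 2 ^ t)%nat /\ inner (graph_pt f) l (graph_pt f p).
Proof.
  induction t as [|t IH]; intros f l H ND B C.
  - exists []. split; [constructor|]. split; [|intros p []].
    pose proof (length_below l 1 ND B). simpl; lia.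
  - destruct H as [H (s & Hs)].
    destruct (classic (exists b, forall x, In x l -> Nat.odd x = b)) as [(b & Hb)|Mixed].
    + destruct (parity_preimage b t l B Hb) as (l' & -> & B').
      pose proof (embeds_parity (2 ^ t) b f) as Emb.
      destruct (IH (restrict b f) l' (H _) (NoDup_map_inv _ _ ND) B'
                  (embeds_convex_pos _ _ _ _ _ Emb B' C)) as (D & NDD & LD & HD).
      exists (map (parity_class b) D).
      split; [now apply NoDup_parity_class|]. rewrite !length_map. split; [assumption|].
      intros p Hp. apply in_map_iff in Hp as (q & <- & Hq).
      destruct (HD q Hq) as (Bq & I).
      split; [now apply parity_class_bound|]. eapply embeds_inner; eauto.
    + (* Both parities occur: each part is a cup or a cap open towards the other one. *)
      assert (Ex : forall b, exists u, In u l /\ Nat.odd u <> b).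
      { intros b. apply NNPP. intros N. apply Mixed. exists b. intros x Hx.
        destruct (Bool.bool_dec (Nat.odd x) b); [assumption|]. exfalso; eauto. }
      destruct (Ex s) as (u & Hu & Pu), (Ex (negb s)) as (v & Hv & Pv).
      destruct (horton_polygon_lower t f s l u) as (D1 & ND1 & L1 & H1); auto.
      destruct (horton_polygon_lower t (opp f) (negb s) l v) as (D2 & ND2 & L2 & H2); auto.
      { exact (horton_opp t _ (H (negb s))). }
      { now apply separated_opp. }
      { intros p Hp In. exact (C p Hp (proj1 (inner_opp _ _ _) In)). }
      exists (D1 ++ D2). rewrite length_app. rewrite (filter_parity_split s l).
      split; [|split; [lia|]].
      * apply NoDup_app; auto. intros x X1 X2.
        destruct (H1 x X1) as [E1 _], (H2 x X2) as [E2 _]. rewrite E1 in E2. now destruct s.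
      * intros p Hp. apply in_app_iff in Hp as [Hp|Hp].
        -- destruct (H1 p Hp); tauto.
        -- destruct (H2 p Hp) as (_ & ? & In). split; [assumption|].
           exact (proj1 (inner_opp _ _ _) In).
Qed.

(** * Existence of Horton sets *)

Lemma turn_graph f i j k :
  turn f i j k = (INR j - INR i) * (f k - f i) - (f j - f i) * (INR k - INR i).
Proof. reflexivity. Qed.

Lemma horton_ext t : forall f g, (forall i, f i = g i) -> horton t f -> horton t g.
Proof.
  induction t as [|t IH]; intros f g E; [trivial|]. intros [H (s & Hs)]. split.
  - intros b. apply (IH (restrict b f)); auto. intros i. apply E.
  - exists s. intros i j k. rewrite !turn_graph, <- !E, <- !turn_graph. apply Hs.
Qed.

Lemma horton_exists t : exists f, horton t f.
Proof.
  induction t as [|t (f & Hf)]; [exists INR; exact I|].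
  (* Two copies of the smaller Horton set are interleaved, the odd one being lifted by [s]. The
     coefficient of [s] in a mixed turn is the difference of two abscissas up to sign, so a large
     [s] separates the copies. *)
  set (h := fun (s : R) i => f (Nat.div2 i) + INR (Nat.b2n (Nat.odd i)) * s).
  assert (E : eventually (fun s => forall i, (i < 2 ^ S t)%nat -> forall j, (j < 2 ^ S t)%nat ->
    forall k, (k < 2 ^ S t)%nat -> (i < j)%nat -> Nat.odd i = Nat.odd j ->
    Nat.odd k <> Nat.odd i ->
    (Nat.odd i = false -> 0 < turn (h s) i j k) /\ (Nat.odd i <> false -> turn (h s) i j k < 0))).
  { apply eventually_below; intros i _. apply eventually_below; intros j _.
    apply eventually_below; intros k _. apply eventually_imp; intros L.
    apply eventually_imp; intros Eq. apply eventually_imp; intros N.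
    assert (LR : 0 < INR j - INR i) by (apply lt_INR in L; lra).
    destruct (Nat.odd i) eqn:Oi.
    - apply eventually_mono with (fun s => turn (h s) i j k < 0); [intros; split; congruence|].
      eapply to_infty_neg; [apply (to_infty_linear (INR j - INR i)
        (- ((INR j - INR i) * (f (Nat.div2 k) - f (Nat.div2 i)) -
         (f (Nat.div2 j) - f (Nat.div2 i)) * (INR k - INR i)))); lra|].
      intros s. rewrite turn_graph. unfold h. rewrite Oi, <- Eq.
      destruct (Nat.odd k); [congruence|]. simpl. ring.
    - apply eventually_mono with (fun s => 0 < turn (h s) i j k); [intros; split; congruence|].
      eapply to_infty_pos; [apply (to_infty_linear (INR j - INR i)
        ((INR j - INR i) * (f (Nat.div2 k) - f (Nat.div2 i)) -
         (f (Nat.div2 j) - f (Nat.div2 i)) * (INR k - INR i))); lra|].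
      intros s. rewrite turn_graph. unfold h. rewrite Oi, <- Eq.
      destruct (Nat.odd k); [|congruence]. simpl. ring. }
  destruct E as [s Hs]. specialize (Hs s (Rle_refl s)).
  exists (h s). split.
  - intros b.
    assert (Ef : forall i, restrict b (h s) i = f i + INR (Nat.b2n b) * s).
    { intros i. unfold restrict, h. rewrite parity_class_odd. do 2 f_equal.
      unfold parity_class. rewrite Nat.add_comm, Nat.mul_comm.
      rewrite Nat.div2_div. rewrite Nat.div_add by lia. destruct b; reflexivity. }
    apply horton_ext with (1 := fun i => eq_sym (Ef i)).
    (* Adding a constant to [f] changes no turn, so each parity class of [h s] is again a Horton
       set. *)
    clear - Hf. set (c := INR (Nat.b2n b) * s). clearbody c. revert f Hf.
    induction t as [|t IH]; intros f; [trivial|]. intros [H (s' & Hs')]. split.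
    + intros b'. exact (IH _ (H b')).
    + exists s'. intros i j k.
      replace (turn (fun i => f i + c) i j k) with (turn f i j k) by (rewrite !turn_graph; ring).
      apply Hs'.
  - exists false. intros i j k L1 L2 L3. apply Hs; lia.
Qed.

(** * Erdős–Szekeres sets *)

(** The first two bounds exclude cups of [u + 2] and caps of [v + 2] points. The third one serves to
    rule out large polygons contained in a single cluster. *)
Definition cup_cap_bounded (u v m : nat) (g : nat -> R) : Prop :=
  no_three_collinear m g /\
  forall l, NoDup l -> (forall x, In x l -> (x < m)%nat) ->
    (cup g l -> (length l <= u + 1)%nat) /\
    (cap g l -> (length l <= v + 1)%nat) /\
    (convex_pos (graph_pt g) l -> (length l <= u + v + 2)%nat).

Lemma cup_cap_bounded_one u v g : cup_cap_bounded u v 1 g.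
Proof.
  split; [intros i j k; lia|]. intros l ND B. pose proof (length_below l 1 ND B).
  repeat split; intros; lia.
Qed.

Lemma binom_small n : forall k, (n < k)%nat -> binom n k = 0%nat.
Proof.
  induction n as [|n IH]; intros [|k] L; simpl; try lia. rewrite !IH by lia. lia.
Qed.

Lemma binom_diag n : binom n n = 1%nat.
Proof. induction n as [|n IH]; [reflexivity|]. simpl. rewrite IH, binom_small; lia. Qed.

Lemma binom_0_r n : binom n 0 = 1%nat.
Proof. now destruct n. Qed.

Lemma binom_pos n : forall k, (k <= n)%nat -> (0 < binom n k)%nat.
Proof.
  induction n as [|n IH]; intros [|k] L; simpl; try lia. specialize (IH k). lia.
Qed.

Section Juxtaposition.

Variables (u v m1 m2 : nat) (g1 g2 h : nat -> R).
Hypotheses (H1 : cup_cap_bounded u (S v) m1 g1) (H2 : cup_cap_bounded (S u) v m2 g2).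
Hypotheses (E1 : embeds m1 g1 h (fun i => i)) (E2 : embeds m2 g2 h (Nat.add m1)).
Hypothesis above : forall i j k, (i < j)%nat -> (j < m1)%nat ->
  (m1 <= k)%nat -> (k < m1 + m2)%nat -> 0 < turn h i j k.
Hypothesis below : forall i j k, (i < m1)%nat -> (m1 <= j)%nat ->
  (j < k)%nat -> (k < m1 + m2)%nat -> turn h i j k < 0.

Lemma juxtaposition_general : no_three_collinear (m1 + m2) h.
Proof.
  intros i j k L1 L2 L3.
  destruct (le_lt_dec m1 i) as [Li|Li].
  - destruct E2 as (_ & c & Hc & EO).
    assert (Q : turn g2 (i - m1) (j - m1) (k - m1) <> 0) by (apply (proj1 H2); lia).
    pose proof (EO (i - m1)%nat (j - m1)%nat (k - m1)%nat ltac:(lia) ltac:(lia) ltac:(lia)) as E.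
    replace (m1 + (i - m1))%nat with i in E by lia.
    replace (m1 + (j - m1))%nat with j in E by lia.
    replace (m1 + (k - m1))%nat with k in E by lia. rewrite E. nra.
  - destruct (le_lt_dec m1 j) as [Lj|Lj].
    + pose proof (below i j k Li Lj L2 L3). lra.
    + destruct (le_lt_dec m1 k) as [Lk|Lk].
      * pose proof (above i j k L1 Lj Lk L3). lra.
      * destruct E1 as (_ & c & Hc & EO). rewrite EO by lia.
        assert (turn g1 i j k <> 0) by (apply (proj1 H1); lia). nra.
Qed.

(** The right part lies above all lines of the left part, and the left part below all lines of the
    right part. If both are met, a cup has at most one point on the right and a cap at most one on
    the left; in a set in convex position the left points form a cup and the right ones a cap. *)
Lemma juxtaposition_bounded : cup_cap_bounded (S u) (S v) (m1 + m2) h.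
Proof.
  split; [exact juxtaposition_general|]. intros l ND B.
  pose proof (filter_length (fun x => (x <? m1)%nat) l) as Len.
  set (L := filter (fun x => (x <? m1)%nat) l) in *.
  set (T := filter (fun x => negb (x <? m1)%nat) l) in *.
  assert (HL : forall x, In x L -> In x l /\ (x < m1)%nat).
  { intros x Hx. apply filter_In in Hx as [? Q]. apply Nat.ltb_lt in Q. auto. }
  assert (HT : forall x, In x T -> In x l /\ (m1 <= x < m1 + m2)%nat).
  { intros x Hx. apply filter_In in Hx as [? Q]. apply Bool.negb_true_iff, Nat.ltb_ge in Q. auto. }
  assert (NL : NoDup L) by now apply NoDup_filter.
  assert (NT : NoDup T) by now apply NoDup_filter.
  assert (IL : incl L l) by (intros x Hx; now apply HL).
  assert (IT : incl T l) by (intros x Hx; now apply HT).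
  destruct (list_preimage (fun i : nat => i) (fun i => (i < m1)%nat) L) as (L' & EL & BL).
  { intros x Hx. exists x. split; [now apply HL|reflexivity]. }
  destruct (list_preimage (Nat.add m1) (fun i => (i < m2)%nat) T) as (T' & ET & BT).
  { intros x Hx. exists (x - m1)%nat. apply HT in Hx. split; lia. }
  pose proof (NoDup_map_inv (fun i : nat => i) L') as NL'. rewrite <- EL in NL'.
  pose proof (NoDup_map_inv (Nat.add m1) T') as NT'. rewrite <- ET in NT'.
  destruct (proj2 H1 L' (NL' NL) BL) as (Cup1 & Cap1 & Con1).
  destruct (proj2 H2 T' (NT' NT) BT) as (Cup2 & Cap2 & Con2).
  assert (LL : length L' = length L) by (rewrite EL, length_map; reflexivity).
  assert (LT : length T' = length T) by (rewrite ET, length_map; reflexivity).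
  rewrite LL in *. rewrite LT in *.
  assert (CupL : cup h L -> (length L <= u + 1)%nat).
  { intros C. apply Cup1, (embeds_cup m1 _ h (fun i => i)); auto. now rewrite <- EL. }
  assert (CapL : cap h L -> (length L <= S v + 1)%nat).
  { intros C. apply Cap1, (embeds_cap m1 _ h (fun i => i)); auto. now rewrite <- EL. }
  assert (ConL : convex_pos (graph_pt h) L -> (length L <= u + S v + 2)%nat).
  { intros C. apply Con1, (embeds_convex_pos m1 _ h (fun i => i)); auto. now rewrite <- EL. }
  assert (CupT : cup h T -> (length T <= S u + 1)%nat).
  { intros C. apply Cup2, (embeds_cup m2 _ h (Nat.add m1)); auto. now rewrite <- ET. }
  assert (CapT : cap h T -> (length T <= v + 1)%nat).
  { intros C. apply Cap2, (embeds_cap m2 _ h (Nat.add m1)); auto. now rewrite <- ET. }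
  assert (ConT : convex_pos (graph_pt h) T -> (length T <= S u + v + 2)%nat).
  { intros C. apply Con2, (embeds_convex_pos m2 _ h (Nat.add m1)); auto. now rewrite <- ET. }
  pose proof juxtaposition_general as Gen.
  clear - Gen above below Len HL HT NL NT IL IT CupL CapL ConL CupT CapT ConT B.
  clearbody L T.
  assert (Cases : length L = 0%nat \/ length T = 0%nat \/
                  exists a b, In a L /\ In b T).
  { destruct L as [|a L], T as [|b T]; simpl; eauto 10. }
  repeat split; intros C.
  - assert (lenL := CupL ltac:(intros i j k Hi Hj Hk; apply C; auto)).
    assert (lenT := CupT ltac:(intros i j k Hi Hj Hk; apply C; auto)).
    destruct Cases as [E|[E|(a & b & Ha & Hb)]]; [lia|lia|].
    assert (length T <= 1)%nat; [|lia].
    apply at_most_one; [assumption|]. intros x y Hx Hy Lxy.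
    destruct (HL a Ha), (HT x Hx), (HT y Hy).
    assert (turn h a x y < 0) by (apply below; lia).
    assert (0 < turn h a x y) by (apply C; auto; lia). lra.
  - assert (lenL := CapL ltac:(intros i j k Hi Hj Hk; apply C; auto)).
    assert (lenT := CapT ltac:(intros i j k Hi Hj Hk; apply C; auto)).
    destruct Cases as [E|[E|(a & b & Ha & Hb)]]; [lia|lia|].
    assert (length L <= 1)%nat; [|lia].
    apply at_most_one; [assumption|]. intros x y Hx Hy Lxy.
    destruct (HT b Hb), (HL x Hx), (HL y Hy).
    assert (0 < turn h x y b) by (apply above; lia).
    assert (turn h x y b < 0) by (apply C; auto; lia). lra.
  - pose proof (ConL (convex_pos_incl _ _ _ IL C)).
    pose proof (ConT (convex_pos_incl _ _ _ IT C)).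
    destruct Cases as [E|[E|(a & b & Ha & Hb)]]; [lia|lia|].
    destruct (HL a Ha) as [Ha' La], (HT b Hb) as [Hb' Lb].
    assert (lenL : (length L <= u + 1)%nat).
    { apply CupL. intros i j k Hi Hj Hk L1 L2.
      destruct (HL i Hi), (HL j Hj), (HL k Hk).
      destruct (Rlt_le_dec 0 (turn h i j k)) as [|Le]; [assumption|exfalso].
      assert (turn h i j k <> 0) by (apply Gen; lia).
      apply (C j); [assumption|]. exists i, k, b. repeat split; auto.
      apply tri_in_above; [apply above; lia|apply above; lia|unfold turn in *; lra]. }
    assert (lenT : (length T <= v + 1)%nat).
    { apply CapT. intros i j k Hi Hj Hk L1 L2.
      destruct (HT i Hi), (HT j Hj), (HT k Hk).
      destruct (Rlt_le_dec (turn h i j k) 0) as [|Le]; [assumption|exfalso].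
      assert (turn h i j k <> 0) by (apply Gen; lia).
      apply (C j); [assumption|]. exists i, k, a. repeat split; auto.
      apply tri_in_below; [| |unfold turn in *; lra].
      - change (turn h i j a < 0). rewrite turn_cycle. apply below; lia.
      - change (turn h j k a < 0). rewrite turn_cycle. apply below; lia. }
    lia.
Qed.

End Juxtaposition.

(** Pascal's rule counts the points of the juxtaposition. For [u = 0] or [v = 0] the binomial
    coefficient is 1 and a single point will do. *)
Lemma cup_cap_bounded_exists u : forall v, exists g, cup_cap_bounded u v (binom (u + v) u) g.
Proof.
  induction u as [|u IHu]; intros v.
  { exists INR. rewrite binom_0_r. apply cup_cap_bounded_one. }
  induction v as [|v IHv].
  { exists INR. rewrite Nat.add_0_r, binom_diag. apply cup_cap_bounded_one. }
  destruct (IHu (S v)) as (g1 & H1), IHv as (g2 & H2).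
  replace (binom (S u + S v) (S u)) with (binom (u + S v) u + binom (S u + v) (S u))%nat
    by (simpl; replace (u + S v)%nat with (S (u + v)) by lia; reflexivity).
  set (m1 := binom (u + S v) u) in *. set (m2 := binom (S u + v) (S u)) in *.
  (* The second set is put to the right of the first and lifted by a large [s]. *)
  set (h := fun (s : R) j => if (j <? m1)%nat then g1 j else g2 (j - m1)%nat + s).
  assert (hl : forall s j, (j < m1)%nat -> h s j = g1 j).
  { intros s j L. unfold h. apply Nat.ltb_lt in L. now rewrite L. }
  assert (hr : forall s j, (m1 <= j)%nat -> h s j = g2 (j - m1)%nat + s).
  { intros s j L. unfold h. apply Nat.ltb_ge in L. now rewrite L. }
  assert (Ev : eventually (fun s => forall i, (i < m1 + m2)%nat -> forall j, (j < m1 + m2)%nat ->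
    forall k, (k < m1 + m2)%nat ->
    ((i < j)%nat -> (j < m1)%nat -> (m1 <= k)%nat -> 0 < turn (h s) i j k) /\
    ((i < m1)%nat -> (m1 <= j)%nat -> (j < k)%nat -> turn (h s) i j k < 0))).
  { apply eventually_below; intros i _. apply eventually_below; intros j _.
    apply eventually_below; intros k _. apply eventually_and.
    - apply eventually_imp; intros L1. apply eventually_imp; intros L2.
      apply eventually_imp; intros L3.
      assert (LR : 0 < INR j - INR i) by (apply lt_INR in L1; lra).
      eapply to_infty_pos; [apply (to_infty_linear (INR j - INR i)
        ((INR j - INR i) * (g2 (k - m1)%nat - g1 i) - (g1 j - g1 i) * (INR k - INR i))); lra|].
      intros s. rewrite turn_graph, (hl s i), (hl s j), (hr s k) by lia. ring.
    - apply eventually_imp; intros L1. apply eventually_imp; intros L2.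
      apply eventually_imp; intros L3.
      assert (LR : 0 < INR k - INR j) by (apply lt_INR in L3; lra).
      eapply to_infty_neg; [apply (to_infty_linear (INR k - INR j)
        (- ((INR j - INR i) * (g2 (k - m1)%nat - g1 i) -
            (g2 (j - m1)%nat - g1 i) * (INR k - INR i)))); lra|].
      intros s. rewrite turn_graph, (hl s i), (hr s j), (hr s k) by lia. ring. }
  destruct Ev as [s Hs]. specialize (Hs s (Rle_refl s)).
  exists (h s). apply juxtaposition_bounded with g1 g2; auto.
  - split; [auto|]. exists 1. split; [lra|]. intros i j k Li Lj Lk.
    rewrite !turn_graph, !hl by assumption. ring.
  - split; [intros; lia|]. exists 1. split; [lra|]. intros i j k _ _ _.
    rewrite !turn_graph, !hr, !plus_INR by lia.
    replace (m1 + i - m1)%nat with i by lia. replace (m1 + j - m1)%nat with j by lia.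
    replace (m1 + k - m1)%nat with k by lia. ring.
  - intros. apply Hs; lia.
  - intros. apply Hs; lia.
Qed.

(** * Horton sets blown up by Erdős–Szekeres clusters *)

(* The cluster at the point [(i, f i)] is the transposed set of points [(g j, j)]. For large [s]
   the scaling by [(s^2, s)] makes it relatively tiny and almost vertical: a line through two of
   its points separates the clusters on its left from those on its right. *)
Definition blowup (s : R) (f g : nat -> R) (q : nat * nat) : point :=
  (s * s * INR (fst q) + g (snd q), s * f (fst q) + INR (snd q)).

(** Inside a cluster the terms with [s] are a common translation; the minus sign comes from the
    transposition. *)
Lemma blowup_cluster s f g i j1 j2 j3 :
  orient (blowup s f g (i, j1)) (blowup s f g (i, j2)) (blowup s f g (i, j3)) = - turn g j1 j2 j3.
Proof. rewrite turn_graph. unfold orient, blowup; simpl. ring. Qed.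

Definition in_grid (n m : nat) (q : nat * nat) : Prop := (fst q < n)%nat /\ (snd q < m)%nat.

(** Besides the signs within a cluster, these are the facts about the position of points that a
    large scale provides. The first clause speaks of positive turns only; negative ones follow by
    exchanging two points. *)
Definition separating (n m : nat) (f : nat -> R) (Q : nat * nat -> point) : Prop :=
  forall q1 q2 q3, in_grid n m q1 -> in_grid n m q2 -> in_grid n m q3 ->
    (0 < turn f (fst q1) (fst q2) (fst q3) -> 0 < orient (Q q1) (Q q2) (Q q3)) /\
    (fst q1 = fst q2 -> (snd q1 < snd q2)%nat -> (fst q1 < fst q3)%nat ->
      orient (Q q1) (Q q2) (Q q3) < 0) /\
    (fst q1 = fst q2 -> (snd q1 < snd q2)%nat -> (fst q3 < fst q1)%nat ->
      0 < orient (Q q1) (Q q2) (Q q3)) /\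
    ((fst q1 < fst q2)%nat -> fst (Q q1) < fst (Q q2)).

Lemma separating_exists n m f g : exists s, separating n m f (blowup s f g).
Proof.
  assert (Ev : eventually (fun s =>
    forall i1, (i1 < n)%nat -> forall i2, (i2 < n)%nat -> forall i3, (i3 < n)%nat ->
    forall j1, (j1 < m)%nat -> forall j2, (j2 < m)%nat -> forall j3, (j3 < m)%nat ->
    let Q := blowup s f g in
    (0 < turn f i1 i2 i3 -> 0 < orient (Q (i1, j1)) (Q (i2, j2)) (Q (i3, j3))) /\
    (i1 = i2 -> (j1 < j2)%nat -> (i1 < i3)%nat ->
      orient (Q (i1, j1)) (Q (i2, j2)) (Q (i3, j3)) < 0) /\
    (i1 = i2 -> (j1 < j2)%nat -> (i3 < i1)%nat ->
      0 < orient (Q (i1, j1)) (Q (i2, j2)) (Q (i3, j3))) /\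
    ((i1 < i2)%nat -> fst (Q (i1, j1)) < fst (Q (i2, j2))))).
  { apply eventually_below; intros i1 _. apply eventually_below; intros i2 _.
    apply eventually_below; intros i3 _. apply eventually_below; intros j1 _.
    apply eventually_below; intros j2 _. apply eventually_below; intros j3 _.
    cbv zeta. repeat apply eventually_and.
    - apply eventually_imp; intros P.
      (* Points in three clusters: a cubic in [s] with leading coefficient [turn f i1 i2 i3]. In the
         next two cases, with two points in one cluster, it is a quadratic whose leading coefficient
         is a product of index differences up to sign. *)
      eapply to_infty_pos; [exact
       (to_infty_horner _ ((g j2 - g j1) * (INR j3 - INR j1) - (INR j2 - INR j1) * (g j3 - g j1))
       (to_infty_horner _ ((g j2 - g j1) * (f i3 - f i1) - (f i2 - f i1) * (g j3 - g j1))
       (to_infty_linear _ ((INR i2 - INR i1) * (INR j3 - INR j1) -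
          (INR j2 - INR j1) * (INR i3 - INR i1)) P)))|].
      intros s. rewrite turn_graph. unfold orient, blowup; simpl. ring.
    - apply eventually_imp; intros <-. apply eventually_imp; intros L.
      apply eventually_imp; intros L3. apply lt_INR in L, L3.
      assert (P : 0 < (INR j2 - INR j1) * (INR i3 - INR i1)) by (apply Rmult_lt_0_compat; lra).
      eapply to_infty_neg; [exact
       (to_infty_horner _
          (- ((g j2 - g j1) * (INR j3 - INR j1) - (INR j2 - INR j1) * (g j3 - g j1)))
       (to_infty_linear _ (- ((g j2 - g j1) * (f i3 - f i1))) P))|].
      intros s. unfold orient, blowup; simpl. ring.
    - apply eventually_imp; intros <-. apply eventually_imp; intros L.
      apply eventually_imp; intros L3. apply lt_INR in L, L3.
      assert (P : 0 < (INR j2 - INR j1) * (INR i1 - INR i3)) by (apply Rmult_lt_0_compat; lra).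
      eapply to_infty_pos; [exact
       (to_infty_horner _
          ((g j2 - g j1) * (INR j3 - INR j1) - (INR j2 - INR j1) * (g j3 - g j1))
       (to_infty_linear _ ((g j2 - g j1) * (f i3 - f i1)) P))|].
      intros s. unfold orient, blowup; simpl. ring.
    - apply eventually_imp; intros L. apply lt_INR in L.
      assert (P : 0 < INR i2 - INR i1) by lra.
      apply eventually_mono with
        (fun s => 0 < fst (blowup s f g (i2, j2)) - fst (blowup s f g (i1, j1))); [intros; lra|].
      eapply to_infty_pos;
        [exact (to_infty_horner _ (g j2 - g j1) (to_infty_linear _ 0 P))|].
      intros s. unfold blowup; simpl. ring. }
  destruct Ev as [s Hs]. specialize (Hs s (Rle_refl s)). exists s.
  intros [i1 j1] [i2 j2] [i3 j3] [? ?] [? ?] [? ?]. simpl in *. now apply Hs.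
Qed.

(** * Convex polygons in the blown-up set *)

Section Blowup.

Variables (t u v m : nat) (f g : nat -> R) (s : R).
Hypotheses (Hf : horton t f) (Hg : cup_cap_bounded u v m g).
Notation Q := (blowup s f g).
Notation grid := (in_grid (2 ^ t) m).
Hypothesis Sep : separating (2 ^ t) m f Q.

Lemma blowup_inj q1 q2 : grid q1 -> grid q2 -> Q q1 = Q q2 -> q1 = q2.
Proof.
  intros G1 G2 E.
  destruct (Sep q1 q2 q1 G1 G2 G1) as (_ & _ & _ & A1).
  destruct (Sep q2 q1 q2 G2 G1 G2) as (_ & _ & _ & A2).
  destruct (lt_eq_lt_dec (fst q1) (fst q2)) as [[L|Ei]|L].
  - specialize (A1 L). rewrite E in A1. lra.
  - destruct q1 as [i j1], q2 as [i' j2]. simpl in Ei. subst i'. f_equal.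
    apply INR_eq. unfold blowup in E. simpl in E. inversion E. lra.
  - specialize (A2 L). rewrite E in A2. lra.
Qed.

Lemma blowup_orient_distinct q1 q2 q3 : grid q1 -> grid q2 -> grid q3 ->
  fst q1 <> fst q2 -> fst q2 <> fst q3 -> fst q1 <> fst q3 -> orient (Q q1) (Q q2) (Q q3) <> 0.
Proof.
  intros G1 G2 G3 D1 D2 D3.
  assert (N : turn f (fst q1) (fst q2) (fst q3) <> 0)
    by (apply (no_three_collinear_distinct _ _ _ _ _ (horton_general t f Hf));
        auto; [apply G1|apply G2|apply G3]).
  destruct (Rlt_le_dec 0 (turn f (fst q1) (fst q2) (fst q3))) as [P|P].
  - pose proof (proj1 (Sep q1 q2 q3 G1 G2 G3) P). lra.
  - pose proof (proj1 (Sep q2 q1 q3 G2 G1 G3)) as P'.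
    rewrite turn_swap, orient_swap in P'. lra.
Qed.

Lemma blowup_orient_pair i j1 j2 q : grid (i, j1) -> grid (i, j2) -> grid q ->
  j1 <> j2 -> fst q <> i -> orient (Q (i, j1)) (Q (i, j2)) (Q q) <> 0.
Proof.
  intros G1 G2 G3 D1 D2.
  assert (W : forall j j', grid (i, j) -> grid (i, j') -> (j < j')%nat ->
            orient (Q (i, j)) (Q (i, j')) (Q q) <> 0).
  { intros j j' G G' L. destruct (Sep (i, j) (i, j') q G G' G3) as (_ & A & B & _).
    simpl in *. destruct (lt_eq_lt_dec (fst q) i) as [[L'|]|L']; [|contradiction|].
    - specialize (B eq_refl L L'). lra.
    - specialize (A eq_refl L L'). lra. }
  destruct (lt_eq_lt_dec j1 j2) as [[L|]|L]; [now apply W|contradiction|].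
  pose proof (W j2 j1 G2 G1 L). rewrite orient_swap in H. lra.
Qed.

Lemma blowup_general q1 q2 q3 : grid q1 -> grid q2 -> grid q3 ->
  q1 <> q2 -> q2 <> q3 -> q1 <> q3 -> orient (Q q1) (Q q2) (Q q3) <> 0.
Proof.
  intros G1 G2 G3 D1 D2 D3.
  destruct q1 as [i1 j1], q2 as [i2 j2], q3 as [i3 j3].
  destruct (Nat.eq_dec i1 i2) as [->|N1].
  - destruct (Nat.eq_dec i2 i3) as [->|N2].
    + rewrite blowup_cluster.
      assert (turn g j1 j2 j3 <> 0); [|lra].
      apply (no_three_collinear_distinct m); try congruence;
        [apply Hg|apply G1|apply G2|apply G3].
    + apply blowup_orient_pair; auto; congruence.
  - destruct (Nat.eq_dec i2 i3) as [->|N2].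
    + rewrite <- orient_cycle. apply blowup_orient_pair; auto; congruence.
    + destruct (Nat.eq_dec i1 i3) as [->|N3].
      * rewrite <- orient_cycle, <- orient_cycle. apply blowup_orient_pair; auto; congruence.
      * now apply blowup_orient_distinct.
Qed.

Lemma blowup_tri_in q a b c : grid q -> grid a -> grid b -> grid c ->
  tri_in (graph_pt f (fst q)) (graph_pt f (fst a)) (graph_pt f (fst b)) (graph_pt f (fst c)) ->
  tri_in (Q q) (Q a) (Q b) (Q c).
Proof.
  intros Gq Ga Gb Gc.
  assert (Neg : forall x y z, grid x -> grid y -> grid z -> turn f (fst x) (fst y) (fst z) < 0 ->
            orient (Q x) (Q y) (Q z) < 0).
  { intros x y z Gx Gy Gz N. pose proof (proj1 (Sep y x z Gy Gx Gz)) as P.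
    rewrite turn_swap, orient_swap in P. lra. }
  assert (Pos : forall x y z, grid x -> grid y -> grid z -> 0 < turn f (fst x) (fst y) (fst z) ->
            0 < orient (Q x) (Q y) (Q z)).
  { intros x y z Gx Gy Gz. apply (Sep x y z Gx Gy Gz). }
  intros [(A & B & C)|(A & B & C)]; [left|right]; repeat split; auto.
Qed.

(** The line through the two points of cluster [i] has [l] on its left and [r] on its right. If [i]
    is below the chord from [l] to [r] in the Horton set, the upper point lies in the triangle of
    [l], [r] and the lower one; if it is above, the roles are exchanged. *)
Lemma blowup_middle_unique W l r i j1 j2 :
  (forall q, In q W -> grid q) -> convex_pos Q W -> In l W -> In r W ->
  In (i, j1) W -> In (i, j2) W -> (fst l < i)%nat -> (i < fst r)%nat -> ~ (j1 < j2)%nat.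
Proof.
  intros G C Hl Hr H1 H2 L1 L2 L.
  destruct (Sep (i, j1) (i, j2) l) as (_ & _ & Left & _); auto.
  destruct (Sep (i, j1) (i, j2) r) as (_ & Right & _); auto. simpl in *.
  specialize (Left eq_refl L L1). specialize (Right eq_refl L L2).
  assert (N : turn f (fst l) i (fst r) <> 0)
    by (apply (horton_general t f Hf); auto; apply (G r Hr)).
  destruct (Rlt_le_dec 0 (turn f (fst l) i (fst r))) as [P|P].
  - apply (C (i, j2) H2). exists l, r, (i, j1). repeat split; auto.
    apply tri_in_below.
    + pose proof (orient_swap (Q (i, j2)) (Q l) (Q (i, j1))).
      pose proof (orient_swap (Q (i, j1)) (Q (i, j2)) (Q l)).
      pose proof (orient_cycle (Q (i, j2)) (Q (i, j1)) (Q l)).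
      pose proof (orient_cycle (Q l) (Q (i, j2)) (Q (i, j1))). lra.
    + rewrite orient_cycle. lra.
    + exact (proj1 (Sep l (i, j2) r (G _ Hl) (G _ H2) (G _ Hr)) P).
  - apply (C (i, j1) H1). exists l, r, (i, j2). repeat split; auto.
    apply tri_in_above.
    + rewrite <- orient_cycle. lra.
    + rewrite <- orient_cycle, orient_swap, orient_cycle. lra.
    + pose proof (proj1 (Sep (i, j1) l r (G _ H1) (G _ Hl) (G _ Hr))) as P'. simpl in P'.
      rewrite turn_swap, orient_swap in P'. lra.
Qed.

(** The extreme clusters contain at most [u + 1] and [v + 1] vertices and contribute one entry each
    to [C], so that [u + v] vertices are lost; every middle cluster loses none. *)
Lemma blowup_clusters W :
  NoDup W -> (forall q, In q W -> grid q) -> convex_pos Q W -> (u + v + 3 <= length W)%nat ->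
  exists C, NoDup C /\ (length W <= u + v + length C)%nat /\
    forall i, In i C -> exists j, In (i, j) W.
Proof.
  intros ND G C Len.
  assert (NE : W <> []) by (intros ->; simpl in Len; lia).
  destruct (exists_argmin fst W NE) as (l & Hl & Ml).
  destruct (exists_argmax fst W NE) as (r & Hr & Mr).
  assert (Snd : forall W' i, incl W' W -> NoDup W' -> (forall q, In q W' -> fst q = i) ->
    NoDup (map snd W') /\ (forall j, In j (map snd W') -> In (i, j) W /\ (j < m)%nat)).
  { intros W' i I ND' Hi. split.
    - apply NoDup_map_inj; [|assumption]. intros [a b] [a' b'] H1 H2 E.
      apply Hi in H1, H2. simpl in *. congruence.
    - intros j Hj. apply in_map_iff in Hj as ([a b] & <- & Hq).
      pose proof (Hi _ Hq) as E. simpl in *. subst a.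
      split; [now apply I|]. apply (G _ (I _ Hq)). }
  assert (NZ : forall i j k, (i < j)%nat -> (j < k)%nat -> (k < m)%nat -> turn g i j k <> 0)
    by apply (proj1 Hg).
  destruct (Nat.eq_dec (fst l) (fst r)) as [E|NEq].
  (* All vertices lie in one cluster, which is too small for [u + v + 3] points in convex
     position. *)
  - exfalso.
    destruct (Snd W (fst l)) as (NJ & BJ); [apply incl_refl|assumption|..].
    { intros q Hq. specialize (Ml q Hq). specialize (Mr q Hq). lia. }
    destruct (proj2 Hg (map snd W) NJ) as (_ & _ & Con); [intros j Hj; now apply BJ|].
    rewrite length_map in Con.
    assert (length W <= u + v + 2)%nat; [|lia]. apply Con.
    intros p Hp (a & b & c & Ha & Hb & Hc & T).
    apply (C (fst l, p)); [now apply BJ|].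
    exists (fst l, a), (fst l, b), (fst l, c). repeat split; try now apply BJ.
    unfold tri_in. rewrite !blowup_cluster. unfold turn. unfold tri_in in T.
    destruct T as [(?&?&?)|(?&?&?)]; [right|left]; repeat split; lra.
  - assert (Llr : (fst l < fst r)%nat) by (specialize (Ml r Hr); lia).
    pose proof (filter_length (fun q => (fst q =? fst l)%nat) W) as Len1.
    set (WL := filter (fun q => (fst q =? fst l)%nat) W) in *.
    set (W' := filter (fun q => negb (fst q =? fst l)%nat) W) in *.
    pose proof (filter_length (fun q => (fst q =? fst r)%nat) W') as Len2.
    set (WR := filter (fun q => (fst q =? fst r)%nat) W') in *.
    set (WM := filter (fun q => negb (fst q =? fst r)%nat) W') in *.
    assert (HWL : forall q, In q WL -> In q W /\ fst q = fst l).
    { intros q Hq. apply filter_In in Hq as [? E]. apply Nat.eqb_eq in E. auto. }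
    assert (HW' : forall q, In q W' -> In q W /\ fst q <> fst l).
    { intros q Hq. apply filter_In in Hq as [? E].
      apply Bool.negb_true_iff, Nat.eqb_neq in E. auto. }
    assert (HWR : forall q, In q WR -> In q W /\ fst q = fst r).
    { intros q Hq. apply filter_In in Hq as [Hq E]. apply Nat.eqb_eq in E. split; [|assumption].
      now apply HW'. }
    assert (HWM : forall q, In q WM -> In q W /\ (fst l < fst q < fst r)%nat).
    { intros q Hq. apply filter_In in Hq as [Hq E].
      apply Bool.negb_true_iff, Nat.eqb_neq in E. apply HW' in Hq as [Hq E'].
      specialize (Ml q Hq). specialize (Mr q Hq). split; [assumption|lia]. }
    assert (NL : NoDup WL) by now apply NoDup_filter.
    assert (NM : NoDup WM) by now apply NoDup_filter, NoDup_filter.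
    assert (NR : NoDup WR) by now apply NoDup_filter, NoDup_filter.
    clearbody WL W' WR WM.
    destruct (Snd WL (fst l)) as (NJL & BJL); auto; [intros q Hq; now apply HWL|
      intros q Hq; now apply HWL|].
    destruct (Snd WR (fst r)) as (NJR & BJR); auto; [intros q Hq; now apply HWR|
      intros q Hq; now apply HWR|].
    destruct (proj2 Hg (map snd WL) NJL) as (CupL & _ & _); [intros j Hj; now apply BJL|].
    destruct (proj2 Hg (map snd WR) NJR) as (_ & CapR & _); [intros j Hj; now apply BJR|].
    rewrite length_map in *.
    assert (LL : (length WL <= u + 1)%nat).
    { apply CupL. intros i j k Hi Hj Hk L1 L2.
      destruct (BJL i Hi) as [Ii Bi], (BJL j Hj) as [Ij Bj], (BJL k Hk) as [Ik Bk].
      destruct (Rlt_le_dec 0 (turn g i j k)) as [|Le]; [assumption|exfalso].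
      specialize (NZ i j k L1 L2 Bk).
      apply (C _ Ij). exists (fst l, i), (fst l, k), r. repeat split; auto.
      (* A cap in [g] is transposed into a left turn, while [r] lies to the right of all lines of
         the leftmost cluster: the middle point falls into the triangle of the other two and [r]. *)
      apply tri_in_below.
      - apply (Sep (fst l, i) (fst l, j) r); auto.
      - apply (Sep (fst l, j) (fst l, k) r); auto.
      - rewrite blowup_cluster. lra. }
    assert (LR : (length WR <= v + 1)%nat).
    { apply CapR. intros i j k Hi Hj Hk L1 L2.
      destruct (BJR i Hi) as [Ii Bi], (BJR j Hj) as [Ij Bj], (BJR k Hk) as [Ik Bk].
      destruct (Rlt_le_dec (turn g i j k) 0) as [|Le]; [assumption|exfalso].
      specialize (NZ i j k L1 L2 Bk).
      apply (C _ Ij). exists (fst r, i), (fst r, k), l. repeat split; auto.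
      apply tri_in_above.
      - apply (Sep (fst r, i) (fst r, j) l); auto.
      - apply (Sep (fst r, j) (fst r, k) l); auto.
      - rewrite blowup_cluster. lra. }
    exists (fst l :: fst r :: map fst WM). repeat split.
    + constructor; [|constructor].
      * intros [E|Hq]; [congruence|]. apply in_map_iff in Hq as (q & E & Hq).
        apply HWM in Hq. lia.
      * intros Hq. apply in_map_iff in Hq as (q & E & Hq). apply HWM in Hq. lia.
      * apply NoDup_map_inj; [|assumption]. intros [a b] [a' b'] H1 H2 E. simpl in E. subst a'.
        apply HWM in H1 as [H1 B1], H2 as [H2 B2]. simpl in *. f_equal.
        pose proof (blowup_middle_unique W l r a b b' G C Hl Hr H1 H2 (proj1 B1) (proj2 B1)).
        pose proof (blowup_middle_unique W l r a b' b G C Hl Hr H2 H1 (proj1 B1) (proj2 B1)).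
        lia.
    + simpl. rewrite length_map. lia.
    + intros i [<-|[<-|Hi]].
      * exists (snd l). now destruct l.
      * exists (snd r). now destruct r.
      * apply in_map_iff in Hi as ([a b] & <- & Hq). exists b. now apply HWM.
Qed.

(** At least [length W - u - v] clusters are met, at least 6 fewer lie inside their polygon in the
    Horton set, and each of the latter supplies all its [m] points. *)
Lemma blowup_polygon W :
  NoDup W -> (forall q, In q W -> grid q) -> convex_pos Q W -> (u + v + 3 <= length W)%nat ->
  exists I, NoDup I /\ ((length W - u - v - 6) * m <= length I)%nat /\
    forall q, In q I -> grid q /\ inner Q W (Q q).
Proof.
  intros ND G C Len.
  destruct (blowup_clusters W ND G C Len) as (Cl & NC & LC & HC).
  assert (BC : forall i, In i Cl -> (i < 2 ^ t)%nat).
  { intros i Hi. destruct (HC i Hi) as (j & Hj). apply (G _ Hj). }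
  (* Used twice: for [(p, j)] a vertex it shows that the clusters met are in convex position, and
     for [(p, j)] in the grid that whole clusters are interior. *)
  assert (Lift : forall p j, In (p, j) W \/ (p < 2 ^ t)%nat /\ (j < m)%nat ->
    inner (graph_pt f) Cl (graph_pt f p) -> inner Q W (Q (p, j))).
  { intros p j Hp (a & b & c & Ha & Hb & Hc & T).
    destruct (HC a Ha) as (ja & Ja), (HC b Hb) as (jb & Jb), (HC c Hc) as (jc & Jc).
    exists (a, ja), (b, jb), (c, jc). repeat split; auto.
    apply blowup_tri_in; auto. destruct Hp as [Hp|Hp]; [now apply G|exact Hp]. }
  destruct (horton_polygon t f Cl Hf NC BC) as (D & NDD & LD & HD).
  { intros p Hp I. destruct (HC p Hp) as (j & Hj). apply (C _ Hj). auto. }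
  exists (list_prod D (seq 0 m)). split; [|split].
  - apply NoDup_prod; [assumption|apply seq_NoDup].
  - rewrite length_prod, length_seq. apply Nat.mul_le_mono_r. lia.
  - intros [p j] Hq. apply in_prod_iff in Hq as [Hp Hj]. apply in_seq in Hj.
    destruct (HD p Hp) as [Bp I].
    assert (B : (p < 2 ^ t)%nat /\ (j < m)%nat) by lia.
    split; [exact B|]. apply Lift; auto.
Qed.

End Blowup.

(** * Choice of parameters and conclusion *)

(** Here [u] is half of [n - 7] or of [n - 8], and the factor [n - u - u - 6], the guaranteed number
    of interior clusters, is 1 for odd and 2 for even [n]. Positivity of the binomial coefficient
    makes the truncated subtraction in [kval] exact. *)
Lemma kval_succ n : (7 <= n)%nat ->
  exists u, (2 * u + 7 <= n)%nat /\ S (kval n) = ((n - u - u - 6) * binom (u + u) u)%nat.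
Proof.
  intros Hn. unfold kval. destruct (Nat.odd n) eqn:P.
  - apply Nat.odd_spec in P as [k Hk]. exists (k - 3)%nat. split; [lia|].
    replace ((n - 7) / 2)%nat with (k - 3)%nat
      by (apply Nat.div_unique with 0%nat; lia).
    replace (n - 7)%nat with (k - 3 + (k - 3))%nat by lia.
    replace (n - (k - 3) - (k - 3) - 6)%nat with 1%nat by lia.
    pose proof (binom_pos (k - 3 + (k - 3)) (k - 3)). lia.
  - assert (E : Nat.even n = true) by (rewrite <- Nat.negb_odd, P; reflexivity).
    apply Nat.even_spec in E as [k Hk]. exists (k - 4)%nat. split; [lia|].
    replace ((n - 8) / 2)%nat with (k - 4)%nat
      by (apply Nat.div_unique with 0%nat; lia).
    replace (n - 8)%nat with (k - 4 + (k - 4))%nat by lia.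
    replace (n - (k - 4) - (k - 4) - 6)%nat with 2%nat by lia.
    pose proof (binom_pos (k - 4 + (k - 4)) (k - 4)). lia.
Qed.

Theorem mainTheorem3 (n : nat) (hn : (7 <= n)%nat) (N : nat) (hN : (0 < N)%nat) :
  exists X : list point,
    NoDup X /\ (N <= length X)%nat /\ general_position X /\
    forall V : list point, convex_ngon_in n X V ->
      exists I : list point,
        NoDup I /\ length I = S (kval n) /\
        forall p, In p I -> In p X /\ in_interior V p.
Proof.
  destruct (kval_succ n hn) as (u & Hu & ->).
  set (m := binom (u + u) u).
  (* Depth [N] gives [2 ^ N] clusters, more than [N] of them, and none is empty. *)
  destruct (horton_exists N) as (f & Hf).
  destruct (cup_cap_bounded_exists u u) as (g & Hg). fold m in Hg.
  destruct (separating_exists (2 ^ N) m f g) as (s & Sep).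
  set (Q := blowup s f g).
  set (grid := list_prod (seq 0 (2 ^ N)) (seq 0 m)).
  assert (Hgrid : forall q, In q grid <-> in_grid (2 ^ N) m q).
  { intros [i j]. unfold grid, in_grid. rewrite in_prod_iff, !in_seq. simpl fst. simpl snd. lia. }
  assert (Inj : forall q1 q2, In q1 grid -> In q2 grid -> Q q1 = Q q2 -> q1 = q2).
  { intros q1 q2 H1 H2. apply (blowup_inj N m f g s Sep); now apply Hgrid. }
  exists (map Q grid). split; [|split; [|split]].
  - apply NoDup_map_inj; [exact Inj|]. apply NoDup_prod; apply seq_NoDup.
  - rewrite length_map. unfold grid. rewrite length_prod, !length_seq.
    assert (0 < m)%nat by (apply binom_pos; lia).
    pose proof (Nat.pow_gt_lin_r 2 N). nia.
  - intros p q r Hp Hq Hr D1 D2 D3.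
    apply in_map_iff in Hp as (a & <- & Ha). apply in_map_iff in Hq as (b & <- & Hb).
    apply in_map_iff in Hr as (c & <- & Hc).
    apply (blowup_general N u u m f g s Hf Hg Sep); try (now apply Hgrid); congruence.
  - intros V HV. pose proof HV as (LV & NV & IV & _).
    destruct (list_preimage Q (in_grid (2 ^ N) m) V) as (W & -> & GW).
    { intros x Hx. apply IV in Hx. apply in_map_iff in Hx as (q & <- & Hq).
      exists q. split; [now apply Hgrid|reflexivity]. }
    rewrite length_map in LV.
    assert (Int : forall p, inner Q W p -> in_interior (map Q W) p).
    { intros p (a & b & c & Ha & Hb & Hc & T).
      apply (tri_in_polygon n _ _ (Q a) (Q b) (Q c) p HV); auto using in_map. }
    destruct (blowup_polygon N u u m f g s Hf Hg Sep W) as (I & NI & LI & HI); auto.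
    { now apply NoDup_map_inv in NV. }
    (* A point in a triangle of vertices is interior to the polygon, and a vertex is not: this is
       the convex position of [W]. *)
    { intros p Hp In. apply Int in In. revert In. apply vertex_not_interior. now apply in_map. }
    { lia. }
    rewrite LV in LI. set (K := ((n - u - u - 6) * m)%nat) in *.
    (* The list [I] may be longer than required; its first [K] entries give the exact number. *)
    assert (IF : forall q, In q (firstn K I) -> In q I).
    { intros q Hq. rewrite <- (firstn_skipn K I). apply in_app_iff. now left. }
    exists (map Q (firstn K I)). split; [|split].
    + apply NoDup_map_inj.
      * intros q1 q2 H1 H2. apply Inj; apply Hgrid, HI, IF; assumption.
      * rewrite <- (firstn_skipn K I) in NI. now apply NoDup_app_remove_r in NI.
    + rewrite length_map, length_firstn. lia.
    + intros p Hp. apply in_map_iff in Hp as (q & <- & Hq). apply IF, HI in Hq as [Gq Iq].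
      split; [apply in_map; now apply Hgrid|]. now apply Int.
Qed.
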